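(* Let $G_1$ and $G_2$ be finite, connected graphs without loops, choose vertices $x\in V(G_1)$ and $y\in V(G_2)$, and let $G=G_1\vee G_2$ be the graph obtained from the disjoint union of $G_1$ and $G_2$ by identifying $x$ and $y$. Let $(\mathbf{d}_1,\mathbf{r}_1)$ and $(\mathbf{d}_2,\mathbf{r}_2)$ be arithmetical structures on $G_1$ and $G_2$, respectively. Let $a=\mathbf{r}_1(x)$, $b=\mathbf{r}_2(y)$, and define $(\mathbf{d},\mathbf{r})$ on $G$ by $\mathbf{d}(v)=\mathbf{d}_1(v)$ for $v\in V(G_1)\setminus\{x\}$, $\mathbf{d}(v)=\mathbf{d}_2(v)$ for $v\in V(G_2)\setminus\{y\}$, $\mathbf{d}$ at the merged vertex equal to $\mathbf{d}_1(x)+\mathbf{d}_2(y)$, and $\mathbf{r}(v)=\frac{b}{\gcd(a,b)}\mathbf{r}_1(v)$ for $v\in V(G_1)$, $\mathbf{r}(v)=\frac{a}{\gcd(a,b)}\mathbf{r}_2(v)$ for $v\in V(G_2)$ (this is an arithmetical structure on $G$). If $\gcd(\mathbf{r}_1(x),\mathbf{r}_2(y))=1$, then \[\mathcal{K}(G;\mathbf{d},\mathbf{r})\cong\mathcal{K}(G_1;\mathbf{d}_1,\mathbf{r}_1)\oplus\mathcal{K}(G_2;\mathbf{d}_2,\mathbf{r}_2).\]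
   Context: For a finite connected loopless graph $H$ with adjacency matrix $A(H)$, an arithmetical structure on $H$ is a pair $(\mathbf{d},\mathbf{r})$ with $\mathbf{d}\in\mathbb{Z}_{\ge0}^{V(H)}$, $\mathbf{r}\in\mathbb{Z}_{>0}^{V(H)}$ whose entries have no nontrivial common factor, and $(\operatorname{diag}(\mathbf{d})-A(H))\mathbf{r}=\mathbf{0}$. The critical group $\mathcal{K}(H;\mathbf{d},\mathbf{r})$ is the torsion subgroup of the cokernel $\mathbb{Z}^{V(H)}/\operatorname{im}(\operatorname{diag}(\mathbf{d})-A(H))$. *)

(* Defs.v *)
From HB Require Import structures.
From mathcomp Require Import all_boot all_order all_algebra.
From mathcomp Require Import boolp.

Set Implicit Arguments.
Unset Strict Implicit.
Unset Printing Implicit Defensive.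
Import Order.TTheory GRing.Theory Num.Theory.
Local Open Scope ring_scope.

(* Finite undirected graphs without loops; parallel edges are allowed. *)
Record multigraph := Multigraph {
  vertex : finType;
  edge : finType;
  ends : edge -> {set vertex};
  ends_card : forall e, #|ends e| = 2%N
}.

Arguments ends {m} e.

Section Graph.
Variable H : multigraph.

(* Entry (u, v) of A(H): the number of edges joining u and v. It vanishes when
   u = v, because [set u; u] has one element. *)
Definition adjacency (u v : vertex H) : nat :=
  #|[set e : edge H | ends e == [set u; v]]|.

Definition connected_graph : Prop :=
  (0 < #|vertex H|)%N /\
  (forall u v : vertex H, connect (fun s t => 0 < adjacency s t)%N u v).

(* The action of the matrix diag(d) - A(H) on Z^V(H). *)
Definition laplacian (d : vertex H -> nat) (f : {ffun vertex H -> int}) :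
    {ffun vertex H -> int} :=
  [ffun u => \sum_v (((d u)%:Z *+ (u == v)) - (adjacency u v)%:Z) * f v].

Record arith_structure := ArithStructure {
  dvec : vertex H -> nat;
  rvec : vertex H -> nat;
  rvec_gt0 : forall v, (0 < rvec v)%N;
  rvec_gcd1 : \big[gcdn/0%N]_v rvec v = 1%N;
  laplacian_rvec : laplacian dvec [ffun v => (rvec v)%:Z] = 0
}.

End Graph.

Section Torsion.
Variable V : zmodType.

Definition torsion_pred : {pred V} :=
  fun z => `[< exists2 n : nat, (0 < n)%N & z *+ n = 0 >].

Lemma torsion_pred_closed : zmod_closed torsion_pred.
Proof.
split=> [|u v]; first by apply/asboolP; exists 1%N; rewrite ?mul0rn.
move=> /asboolP[m m0 um] /asboolP[n n0 vn]; apply/asboolP.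
exists (m * n)%N; first by rewrite muln_gt0 m0.
by rewrite mulrnBl mulrnA um mul0rn mulnC mulrnA vn mul0rn subrr.
Qed.

HB.instance Definition _ :=
  GRing.isZmodClosed.Build V torsion_pred torsion_pred_closed.

Record torsion := Torsion { torsion_val : V; _ : torsion_val \in torsion_pred }.

HB.instance Definition _ := [isSub for torsion_val].
HB.instance Definition _ := [Choice of torsion by <:].
HB.instance Definition _ := [SubChoice_isSubZmodule of torsion by <:].

End Torsion.

Section CriticalGroup.
Variables (H : multigraph) (s : arith_structure H).

Definition laplacian_im : {pred {ffun vertex H -> int}} :=
  fun f => `[< exists g, f = laplacian (dvec s) g >].

Lemma laplacian_im_closed : zmod_closed laplacian_im.
Proof.
split=> [|f g].
  apply/asboolP; exists 0; apply/ffunP=> u; rewrite !ffunE big1 // => v _.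
  by rewrite ffunE mulr0.
move=> /asboolP[f' ->] /asboolP[g' ->]; apply/asboolP; exists (f' - g').
apply/ffunP=> u; rewrite !ffunE -sumrB; apply: eq_bigr => v _.
by rewrite !ffunE mulrBr.
Qed.

HB.instance Definition _ :=
  GRing.isZmodClosed.Build {ffun vertex H -> int} laplacian_im
    laplacian_im_closed.

Definition cokernel : zmodType := Quotient.quot laplacian_im.

Definition critical_group : zmodType := torsion cokernel.

End CriticalGroup.

Definition zmod_isomorphic (U V : zmodType) : Prop :=
  exists f : {additive U -> V}, bijective f.

Lemma card_imset_ends (V' V E : finType) (h : V' -> V) (en : E -> {set V'})
    (p q : V) : injective h ->
  #|[set e | h @: en e == [set p; q]]| =
  (\sum_(u | h u == p) \sum_(w | h w == q) #|[set e | en e == [set u; w]]|)%N.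
Proof.
move=> h_inj.
case: (pickP (fun u => h u == p)) => [u /eqP <-|no_u]; last first.
  rewrite big_pred0; last exact: no_u.
  apply/eqP; rewrite cards_eq0 -subset0; apply/subsetP=> e.
  rewrite inE => /eqP/setP/(_ p); rewrite !inE eqxx.
  by case/imsetP=> u _ /esym/eqP; rewrite no_u.
rewrite (big_pred1 u); last by move=> z; rewrite (inj_eq h_inj).
case: (pickP (fun w => h w == q)) => [w /eqP <-|no_w]; last first.
  rewrite big_pred0; last exact: no_w.
  apply/eqP; rewrite cards_eq0 -subset0; apply/subsetP=> e.
  rewrite inE => /eqP/setP/(_ q); rewrite !inE eqxx orbT.
  by case/imsetP=> w _ /esym/eqP; rewrite no_w.
rewrite (big_pred1 w); last by move=> z; rewrite (inj_eq h_inj).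
apply: eq_card => e; rewrite !inE -imset_set1 -imset_set1 -imsetU.
by rewrite (inj_eq (imset_inj h_inj)).
Qed.

Lemma laplacian_eq0 (H : multigraph) (d r : vertex H -> nat) :
  laplacian d [ffun v => (r v)%:Z] = 0 <->
  (forall u, d u * r u = \sum_v adjacency u v * r v)%N.
Proof.
have E u : laplacian d [ffun v => (r v)%:Z] u =
    (d u * r u)%N%:Z - (\sum_v adjacency u v * r v)%N%:Z.
  rewrite ffunE; under [LHS]eq_bigr => v _ do rewrite ffunE mulrBl.
  rewrite sumrB (bigD1 u) //= eqxx mulr1n big1 ?addr0; last first.
    by move=> v; rewrite eq_sym => /negPf->; rewrite mulr0n mul0r.
  by rewrite -PoszM (big_morph Posz PoszD (erefl 0%:Z)).
split=> [L0 u | L0].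
  by have := E u; rewrite L0 ffunE => /esym/eqP; rewrite subr_eq0 => /eqP[].
by apply/ffunP=> u; rewrite E L0 subrr ffunE.
Qed.

Section Wedge.
Variables (G1 G2 : multigraph) (x : vertex G1) (y : vertex G2).

(* The merged vertex is represented by inl x. The two maps below are the
   restrictions to V(G1) and V(G2) of the projection of the disjoint union
   V(G1) + V(G2) onto its quotient; see wedge_projP and wedge_proj_surj. *)
Definition wedge_vertex : finType := (vertex G1 + {v : vertex G2 | v != y})%type.

Definition wedge_in1 (u : vertex G1) : wedge_vertex := inl u.

Definition wedge_in2 (v : vertex G2) : wedge_vertex :=
  if insub v is Some w then inr w else inl x.

Definition wedge_proj (p : vertex G1 + vertex G2) : wedge_vertex :=
  match p with inl u => wedge_in1 u | inr v => wedge_in2 v end.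

Lemma wedge_in1_inj : injective wedge_in1. Proof. by move=> u v []. Qed.

Lemma wedge_in2_y : wedge_in2 y = wedge_in1 x.
Proof. by rewrite /wedge_in2 insubF // eqxx. Qed.

Lemma wedge_in2_inr (w : {v : vertex G2 | v != y}) :
  wedge_in2 (val w) = inr w.
Proof. by rewrite /wedge_in2 valK. Qed.

Lemma wedge_in2_inj : injective wedge_in2.
Proof.
move=> u v; rewrite /wedge_in2.
case: insubP => [u' _ <-|/negPn/eqP->]; case: insubP => [v' _ <-|/negPn/eqP->] //.
by case=> ->.
Qed.

Lemma wedge_in12 u v : wedge_in1 u = wedge_in2 v <-> u = x /\ v = y.
Proof.
split=> [|[-> ->]]; last by rewrite wedge_in2_y.
by rewrite /wedge_in2; case: insubP => [//|/negPn/eqP-> [->]].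
Qed.

Lemma wedge_proj_surj p : exists q, wedge_proj q = p.
Proof.
case: p => [u|w]; first by exists (inl u).
by exists (inr (val w)); rewrite /= wedge_in2_inr.
Qed.

Lemma wedge_projP p q : wedge_proj p = wedge_proj q <->
  [\/ p = q, p = inl x /\ q = inr y | p = inr y /\ q = inl x].
Proof.
split; last by case=> [->//|[-> ->]|[-> ->]] /=; rewrite wedge_in2_y.
case: p q => [u|u] [v|v] /=.
- by move/wedge_in1_inj->; constructor 1.
- by move/wedge_in12=> [-> ->]; constructor 2.
- by move/esym/wedge_in12=> [-> ->]; constructor 3.
- by move/wedge_in2_inj->; constructor 1.
Qed.

Definition wedge_ends (e : edge G1 + edge G2) : {set wedge_vertex} :=
  match e with
  | inl e1 => wedge_in1 @: ends e1
  | inr e2 => wedge_in2 @: ends e2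
  end.

Lemma wedge_ends_card e : #|wedge_ends e| = 2%N.
Proof.
case: e => e /=; rewrite card_imset ?ends_card //.
  exact: wedge_in1_inj.
exact: wedge_in2_inj.
Qed.

Definition wedge : multigraph := Multigraph wedge_ends_card.

Lemma adjacency_wedge (p q : vertex wedge) : adjacency p q =
  (\sum_(u | wedge_in1 u == p) \sum_(w | wedge_in1 w == q) adjacency u w +
   \sum_(u | wedge_in2 u == p) \sum_(w | wedge_in2 w == q) adjacency u w)%N.
Proof.
rewrite /adjacency -(card_imset_ends _ _ _ wedge_in1_inj).
rewrite -(card_imset_ends _ _ _ wedge_in2_inj) -!sum1_card big_sumType /=.
by congr (_ + _)%N; apply: eq_bigl => e; rewrite !inE.
Qed.

Lemma adjacency_wedge1 u w : (adjacency u w <= @adjacency wedge (wedge_in1 u) (wedge_in1 w))%N.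
Proof.
rewrite adjacency_wedge (big_pred1 u); last by move=> z; rewrite (inj_eq wedge_in1_inj).
rewrite (big_pred1 w); last by move=> z; rewrite (inj_eq wedge_in1_inj).
exact: leq_addr.
Qed.

Lemma adjacency_wedge2 u w : (adjacency u w <= @adjacency wedge (wedge_in2 u) (wedge_in2 w))%N.
Proof.
rewrite adjacency_wedge addnC.
rewrite (big_pred1 u); last by move=> z; rewrite (inj_eq wedge_in2_inj).
rewrite (big_pred1 w); last by move=> z; rewrite (inj_eq wedge_in2_inj).
exact: leq_addr.
Qed.

Lemma wedge_connected :
  connected_graph G1 -> connected_graph G2 -> connected_graph wedge.
Proof.
case=> _ c1 [_ c2]; split; first by apply/card_gt0P; exists (wedge_in1 x).
pose r : rel (vertex wedge) := fun s t => (0 < adjacency s t)%N.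
have C1 u v : connect r (wedge_in1 u) (wedge_in1 v).
  have /connectP[p] := c1 u v; elim: p u => [|w p IHp] u /=.
    by move=> _ ->; apply: connect0.
  case/andP=> uw /IHp/[apply]; apply: connect_trans; apply: connect1.
  exact: leq_trans uw (adjacency_wedge1 _ _).
have C2 u v : connect r (wedge_in2 u) (wedge_in2 v).
  have /connectP[p] := c2 u v; elim: p u => [|w p IHp] u /=.
    by move=> _ ->; apply: connect0.
  case/andP=> uw /IHp/[apply]; apply: connect_trans; apply: connect1.
  exact: leq_trans uw (adjacency_wedge2 _ _).
move=> p q; have [p' <-] := wedge_proj_surj p; have [q' <-] := wedge_proj_surj q.
case: p' q' => [u|u] [v|v] /=; rewrite -/r ?C1 ?C2 //.
  by apply: connect_trans (C1 _ x) _; rewrite -wedge_in2_y.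
by apply: connect_trans (C2 _ y) _; rewrite wedge_in2_y.
Qed.

Variables (s1 : arith_structure G1) (s2 : arith_structure G2).
Local Notation a := (rvec s1 x).
Local Notation b := (rvec s2 y).

Definition wedge_dvec (p : vertex wedge) : nat :=
  match p with
  | inl u => if u == x then (dvec s1 x + dvec s2 y)%N else dvec s1 u
  | inr w => dvec s2 (val w)
  end.

Definition wedge_rvec (p : vertex wedge) : nat :=
  match p with
  | inl u => (b %/ gcdn a b * rvec s1 u)%N
  | inr w => (a %/ gcdn a b * rvec s2 (val w))%N
  end.

Lemma wedge_rvec_in1 u :
  wedge_rvec (wedge_in1 u) = (b %/ gcdn a b * rvec s1 u)%N.
Proof. by []. Qed.

Lemma wedge_rvec_in2 v :
  wedge_rvec (wedge_in2 v) = (a %/ gcdn a b * rvec s2 v)%N.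
Proof.
rewrite /wedge_in2; case: insubP => [w _ <- //|/negPn/eqP-> /=].
rewrite mulnC muln_divA ?dvdn_gcdr // mulnC [RHS]mulnC.
by rewrite muln_divA ?dvdn_gcdl.
Qed.

Lemma wedge_rvec_gt0 p : (0 < wedge_rvec p)%N.
Proof.
have a0 : (0 < a)%N by apply: rvec_gt0.
have b0 : (0 < b)%N by apply: rvec_gt0.
have g0 : (0 < gcdn a b)%N by rewrite gcdn_gt0 a0.
case: p => [u|w] /=; rewrite muln_gt0 rvec_gt0 andbT divn_gt0 //.
  by rewrite dvdn_leq ?dvdn_gcdr.
by rewrite dvdn_leq ?dvdn_gcdl.
Qed.

Lemma wedge_rvec_gcd1 : \big[gcdn/0%N]_p wedge_rvec p = 1%N.
Proof.
have a0 : (0 < a)%N by apply: rvec_gt0.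
have g0 : (0 < gcdn a b)%N by rewrite gcdn_gt0 a0.
set D := LHS; have Dp p : (D %| wedge_rvec p)%N.
  by apply: (biggcdn_inf p) (dvdnn _).
have Db : (D %| b %/ gcdn a b)%N.
  rewrite -[X in (_ %| X)%N]muln1 -(rvec_gcd1 s1).
  rewrite (big_morph _ (muln_gcdr _) (muln0 _)).
  by apply/dvdn_biggcdP=> u _; rewrite -wedge_rvec_in1.
have Da : (D %| a %/ gcdn a b)%N.
  rewrite -[X in (_ %| X)%N]muln1 -(rvec_gcd1 s2).
  rewrite (big_morph _ (muln_gcdr _) (muln0 _)).
  by apply/dvdn_biggcdP=> u _; rewrite -wedge_rvec_in2.
apply/eqP; rewrite -dvdn1.
suff <- : gcdn (a %/ gcdn a b) (b %/ gcdn a b) = 1%N by rewrite dvdn_gcd Da.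
apply/eqP; rewrite -(eqn_pmul2r g0) mul1n muln_gcdl.
by rewrite !divnK ?dvdn_gcdl ?dvdn_gcdr.
Qed.

Lemma wedge_laplacian_rvec :
  laplacian wedge_dvec [ffun p => (wedge_rvec p)%:Z] = 0.
Proof.
have L1 := (laplacian_eq0 _ _).1 (laplacian_rvec s1).
have L2 := (laplacian_eq0 _ _).1 (laplacian_rvec s2).
apply/laplacian_eq0 => p.
have -> : (\sum_q adjacency p q * wedge_rvec q =
    \sum_(u | wedge_in1 u == p) dvec s1 u * wedge_rvec (wedge_in1 u) +
    \sum_(v | wedge_in2 v == p) dvec s2 v * wedge_rvec (wedge_in2 v))%N.
  have K (V' : finType) (h : V' -> vertex wedge) (A : V' -> V' -> nat) u :
    (\sum_q (\sum_(w | h w == q) A u w) * wedge_rvec q =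
     \sum_w A u w * wedge_rvec (h w))%N.
    rewrite [RHS](partition_big h predT) //=; apply: eq_bigr => q _.
    by rewrite big_distrl /=; apply: eq_bigr => w /eqP->.
  under eq_bigr => q _ do rewrite adjacency_wedge mulnDl !big_distrl.
  rewrite big_split /=; congr (_ + _)%N; rewrite exchange_big /=.
    apply: eq_bigr => u _; rewrite K mulnCA L1 big_distrr /=.
    by apply: eq_bigr => w _; rewrite mulnCA.
  apply: eq_bigr => u _; rewrite K wedge_rvec_in2 mulnCA L2 big_distrr /=.
  by apply: eq_bigr => w _; rewrite wedge_rvec_in2 mulnCA.
case: p => [u|w].
  rewrite (big_pred1 u) //=; case: eqP => [->|/eqP ux].
    rewrite (big_pred1 y); last first.
      by move=> v; rewrite -[inl x]wedge_in2_y (inj_eq wedge_in2_inj).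
    by rewrite wedge_in2_y mulnDl.
  rewrite big_pred0 ?addn0 // => v; apply/eqP => /esym/wedge_in12[/eqP].
  by rewrite (negPf ux).
rewrite big_pred0 // add0n (big_pred1 (val w)) ?wedge_in2_inr // => v.
by rewrite -wedge_in2_inr (inj_eq wedge_in2_inj).
Qed.

Definition wedge_structure : arith_structure wedge :=
  ArithStructure wedge_rvec_gt0 wedge_rvec_gcd1 wedge_laplacian_rvec.

End Wedge.

(* Main.v *)
(* Every Laplacian is symmetric and kills r, so pairing with r (the degree)
   kills its image, and torsion classes have degree 0. Pushing functions forward
   from both sides of the wedge gives a map K(G1) + K(G2) -> K(G). It is well
   defined because gcd(a, b) = 1: adding multiples of r1 and r2 to potentials g1
   and g2 makes them agree at the merged vertex without changing their images.
   Two pairs with the same push-forward differ by k (delta_x, - delta_y), which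
   has degree a k on G1. So degree 0 on G1 forces k = 0, whence injectivity. For
   surjectivity, b deg f1 + a deg f2 = 0 with gcd(a, b) = 1 lets one choose k
   such that f1 - k delta_x has degree 0. *)
Require Import Defs.
From mathcomp Require Import all_boot all_order all_algebra.
From HB Require Import structures.
From mathcomp Require Import boolp ring.

Set Implicit Arguments.
Unset Strict Implicit.
Unset Printing Implicit Defensive.
Import Order.TTheory GRing.Theory Num.Theory.
Local Open Scope ring_scope.
Local Open Scope quotient_scope.

(** The inverse, obtained by choosing preimages, is additive because [f] is. The conclusion runs
    from [V] to [U] because the map built below goes from the product to the critical group of the
    wedge. *)
Lemma zmod_isomorphic_of_bij (U V : zmodType) (f : {additive U -> V}) :
  injective f -> (forall v, exists u, f u = v) -> zmod_isomorphic V U.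
Proof.
move=> f_inj f_surj.
have f_surjb v : exists u, f u == v.
  by have [u <-] := f_surj v; exists u.
pose g v := xchoose (f_surjb v).
have gK : cancel g f by move=> v; exact/eqP/(xchooseP (f_surjb v)).
have fK : cancel f g by move=> u; apply: f_inj; rewrite gK.
pose gadd := GRing.isZmodMorphism.Build V U g (can2_zmod_morphism fK gK).
pose G : {additive V -> U} := HB.pack g gadd.
by exists G; exists f.
Qed.

(** * Push-forward of integer functions along a map of vertex sets *)

Section Pushforward.
Variables (V' V : finType) (h : V' -> V).

Definition push (f : {ffun V' -> int}) : {ffun V -> int} :=
  [ffun p => \sum_(u | h u == p) f u].

Lemma push_is_zmod_morphism : zmod_morphism push.
Proof.
move=> f g; apply/ffunP=> p; rewrite !ffunE -sumrB.
by apply: eq_bigr => u _; rewrite !ffunE.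
Qed.

HB.instance Definition _ :=
  GRing.isZmodMorphism.Build _ _ push push_is_zmod_morphism.

Hypothesis h_inj : injective h.

Lemma push_in f u : push f (h u) = f u.
Proof. by rewrite ffunE (big_pred1 u) // => w; rewrite (inj_eq h_inj). Qed.

Lemma push_out f p : (forall u, h u != p) -> push f p = 0.
Proof. by move=> out; rewrite ffunE big_pred0 // => u; apply: negPf. Qed.

End Pushforward.

Definition point (V : finType) (x : V) (k : int) : {ffun V -> int} :=
  [ffun v => if v == x then k else 0].

Lemma push_point (V W : finType) (h : V -> W) x k :
  push h (point x k) = point (h x) k.
Proof.
apply/ffunP=> p; rewrite !ffunE; under eq_bigr do rewrite ffunE.
rewrite -big_mkcondr /=.
rewrite (eq_bigl (fun u => (h x == p) && (u == x))); last first.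
  by move=> u; case: (u =P x) => [->|]; rewrite ?andbF.
rewrite [p == _]eq_sym; case: eqP => _ /=; last by rewrite big_pred0.
by rewrite big_pred1_eq.
Qed.

(** * Laplacian, degree and cokernel of a single arithmetical structure *)

Section Arithmetical.
Variable H : multigraph.

Lemma laplacianE (d : vertex H -> nat) f u :
  laplacian d f u = (d u)%:Z * f u - \sum_v (adjacency u v)%:Z * f v.
Proof.
rewrite ffunE; under eq_bigr => v _ do rewrite mulrBl.
rewrite sumrB (bigD1 u) //= eqxx mulr1n big1 ?addr0 // => v.
by rewrite eq_sym => /negPf->; rewrite mulr0n mul0r.
Qed.

Lemma laplacian_is_zmod_morphism (d : vertex H -> nat) :
  zmod_morphism (laplacian d).
Proof.
move=> f g; apply/ffunP=> u; rewrite !ffunE -sumrB.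
by apply: eq_bigr => v _; rewrite !ffunE mulrBr.
Qed.

HB.instance Definition _ (d : vertex H -> nat) :=
  GRing.isZmodMorphism.Build _ _ (laplacian d) (laplacian_is_zmod_morphism d).

Variable s : arith_structure H.

Definition degree (f : {ffun vertex H -> int}) : int :=
  \sum_v (rvec s v)%:Z * f v.

Lemma degree_is_zmod_morphism : zmod_morphism degree.
Proof.
by move=> f g; rewrite -sumrB; apply: eq_bigr => v _; rewrite !ffunE mulrBr.
Qed.

HB.instance Definition _ :=
  GRing.isZmodMorphism.Build _ _ degree degree_is_zmod_morphism.

Lemma degree_point x k : degree (point x k) = (rvec s x)%:Z * k.
Proof.
rewrite /degree (bigD1 x) //= big1 ?addr0 ?ffunE ?eqxx // => v /negPf vx.
by rewrite ffunE vx mulr0.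
Qed.

Lemma degree_laplacian g : degree (laplacian (dvec s) g) = 0.
Proof.
pose r := [ffun v => (rvec s v)%:Z].
have r0 u : laplacian (dvec s) r u = 0 by rewrite laplacian_rvec ffunE.
rewrite /degree; under eq_bigr => v _ do rewrite ffunE big_distrr.
rewrite exchange_big big1 // => u _ /=.
(* After exchanging the sums, symmetry of the matrix moves the Laplacian from [g] onto [r], which it
   kills. *)
transitivity (laplacian (dvec s) r u * g u); last by rewrite r0 mul0r.
rewrite ffunE big_distrl; apply: eq_bigr => v _ /=.
rewrite mulrA; congr (_ * _); rewrite mulrC ffunE eq_sym; congr (_ * _).
congr (_ - _); first by case: eqP => [->|].
by rewrite /adjacency setUC.
Qed.

Definition coker_class (f : {ffun vertex H -> int}) : cokernel s :=
  \pi_(Quotient.quot (laplacian_im s)) f.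

Lemma coker_class_is_zmod_morphism : zmod_morphism coker_class.
Proof. exact: (raddfB \pi_(Quotient.quot (laplacian_im s))). Qed.

HB.instance Definition _ :=
  GRing.isZmodMorphism.Build _ (cokernel s) coker_class
    coker_class_is_zmod_morphism.

Definition coker_repr (z : cokernel s) : {ffun vertex H -> int} :=
  repr (z : Quotient.quot (laplacian_im s)).

Lemma coker_reprK : cancel coker_repr coker_class.
Proof. by move=> z; apply: reprK. Qed.

Lemma coker_class_eq0 f :
  coker_class f = 0 <-> exists g, f = laplacian (dvec s) g.
Proof.
rewrite -(raddf0 coker_class); split.
  by move/eqP; rewrite -Quotient.idealrBE subr0 => /asboolP.
by move=> im_f; apply/eqP; rewrite -Quotient.idealrBE subr0; apply/asboolP.
Qed.

(** If [n] times [f] is a Laplacian, then [n] times its degree is 0, and the integers have no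
    torsion. *)
Lemma torsion_degree0 f :
  coker_class f \in @torsion_pred (cokernel s) -> degree f = 0.
Proof.
case/asboolP=> n n0; rewrite -raddfMn => /coker_class_eq0[g def_f].
have /eqP := degree_laplacian g; rewrite -def_f raddfMn.
by rewrite mulrn_eq0 eqn0Ngt n0 => /eqP.
Qed.

End Arithmetical.

(** * Splitting Laplacians and functions on the wedge into the two sides *)

Section Wedge.
Variables (G1 G2 : multigraph) (x : vertex G1) (y : vertex G2).
Variables (s1 : arith_structure G1) (s2 : arith_structure G2).

Local Notation G := (wedge x y).
Local Notation s := (wedge_structure x y s1 s2).
Local Notation in1 := (@wedge_in1 G1 G2 y).
Local Notation in2 := (@wedge_in2 G1 G2 x y).
Local Notation L := (laplacian (dvec s)).
Local Notation L1 := (laplacian (dvec s1)).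
Local Notation L2 := (laplacian (dvec s2)).

Lemma wedge_dvecE (p : vertex G) :
  (wedge_dvec s1 s2 p =
   \sum_(u | in1 u == p) dvec s1 u + \sum_(v | in2 v == p) dvec s2 v)%N.
Proof.
case: p => [u|w] /=; last first.
  rewrite big_pred0 // add0n (big_pred1 (val w)) // => v.
  by rewrite -(wedge_in2_inr x w) (inj_eq (@wedge_in2_inj _ _ _ _)).
rewrite (big_pred1 u) //; case: eqP => [->|/eqP ux].
  rewrite (big_pred1 y) // => v.
  by rewrite -[inl x](wedge_in2_y x y) (inj_eq (@wedge_in2_inj _ _ _ _)).
rewrite big_pred0 ?addn0 // => v; apply/eqP => /esym/wedge_in12[/eqP].
by rewrite (negPf ux).
Qed.

(** Degrees and adjacencies of the wedge are sums of contributions from the two sides, and each side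
    sees only the restriction of [g]. *)
Lemma laplacian_wedge (g : {ffun vertex G -> int}) :
  L g =
  push in1 (L1 [ffun u => g (in1 u)]) + push in2 (L2 [ffun v => g (in2 v)]).
Proof.
(* Regroups a sum over one side by the fibres of [h]. *)
have K (V' : finType) (h : V' -> vertex G) (A : V' -> V' -> nat) u :
    \sum_q (\sum_(w | h w == q) A u w)%N%:Z * g q =
    \sum_w (A u w)%:Z * [ffun w' => g (h w')] w.
  rewrite [RHS](partition_big h predT) //=; apply: eq_bigr => q _.
  rewrite (big_morph Posz PoszD (erefl 0%:Z)) big_distrl /=.
  by apply: eq_bigr => w /eqP hw; rewrite ffunE hw.
apply/ffunP=> p; rewrite laplacianE [RHS]ffunE 2![push _ _ _]ffunE.
under [X in _ = X + _]eq_bigr => u /eqP up do rewrite laplacianE ffunE up.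
under [X in _ = _ + X]eq_bigr => u /eqP up do rewrite laplacianE ffunE up.
rewrite !sumrB addrACA -!big_distrl -mulrDl -opprD /=.
congr (_ * _ - _).
  by rewrite wedge_dvecE PoszD !(big_morph Posz PoszD (erefl 0%:Z)).
under eq_bigr => q _.
  rewrite adjacency_wedge PoszD mulrDl.
  rewrite 2!(big_morph Posz PoszD (erefl 0%:Z)) !big_distrl /=.
  over.
rewrite big_split /=; congr (_ + _); rewrite exchange_big /=.
  by apply: eq_bigr => u _; rewrite K.
by apply: eq_bigr => u _; rewrite K.
Qed.

(** The two sides overlap only in the merged vertex: elsewhere each function must vanish, and there
    the two values cancel. *)
Lemma push_wedge_eq0 f1 f2 : push in1 f1 + push in2 f2 = 0 ->
  exists k, f1 = point x k /\ f2 = point y (- k).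
Proof.
move=> /ffunP f0; exists (f1 x); split; apply/ffunP=> v; rewrite ffunE.
  case: eqP => [->|/eqP vx] //; have := f0 (in1 v).
  rewrite ffunE [RHS]ffunE push_in; last exact: wedge_in1_inj.
  rewrite push_out ?addr0 // => w; apply/eqP => /esym/wedge_in12[/eqP].
  by rewrite (negPf vx).
have := f0 (in2 v); rewrite ffunE [RHS]ffunE.
rewrite [X in _ + X]push_in; last exact: wedge_in2_inj.
case: eqP => [->|/eqP vy].
  rewrite wedge_in2_y push_in; last exact: wedge_in1_inj.
  by move/eqP; rewrite addrC addr_eq0 => /eqP.
rewrite push_out ?add0r // => u; apply/eqP => /wedge_in12[_ /eqP].
by rewrite (negPf vy).
Qed.

Lemma push_wedge_surj (f : {ffun vertex G -> int}) :
  exists f1 f2, f = push in1 f1 + push in2 f2.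
Proof.
(* The value at the merged vertex goes to the first side; the 0 at [y] keeps it from being counted
   twice. *)
exists [ffun u => f (in1 u)], [ffun v => if v == y then 0 else f (in2 v)].
apply/ffunP=> p; have [[u|v] <-] := @wedge_proj_surj _ _ x y p; rewrite ffunE /=.
  rewrite push_in; last exact: wedge_in1_inj.
  rewrite [push in2 _ _]ffunE big1 ?addr0 ?ffunE // => v /eqP/esym.
  by case/wedge_in12=> _ ->; rewrite ffunE eqxx.
rewrite [push in2 _ _]push_in; last exact: wedge_in2_inj.
rewrite ffunE; case: eqP => [->|/eqP vy].
  by rewrite wedge_in2_y push_in ?ffunE ?addr0 //; apply: wedge_in1_inj.
rewrite push_out ?add0r // => u; apply/eqP => /wedge_in12[_ /eqP].
by rewrite (negPf vy).
Qed.

(** The differences [f1 - L1 g1] and [f2 - L2 g2] have cancelling push-forwards, so they are point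
    masses [k] and [- k]; comparing degrees on the first side gives [a k = 0], where [a > 0] is the
    entry of [s1] at [x]. *)
Lemma laplacian_im_wedge f1 f2 g :
  degree s1 f1 = 0 -> push in1 f1 + push in2 f2 = L g ->
  (exists g1, f1 = L1 g1) /\ (exists g2, f2 = L2 g2).
Proof.
rewrite laplacian_wedge; set g1 := [ffun u => _]; set g2 := [ffun v => _].
move=> deg_f1 /eqP; rewrite -subr_eq0 opprD addrACA -!raddfB /=.
case/eqP/push_wedge_eq0=> k [Df1 Df2].
have := degree_point s1 x k.
rewrite -Df1 raddfB /= deg_f1 degree_laplacian subrr => /esym/eqP.
rewrite mulf_eq0 eqz_nat eqn0Ngt rvec_gt0 /= => /eqP k0.
have point0 (V : finType) (z : V) : point z 0 = 0.
  by apply/ffunP=> v; rewrite !ffunE if_same.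
split; [exists g1 | exists g2]; apply/eqP; rewrite -subr_eq0.
  by rewrite Df1 k0 point0.
by rewrite Df2 k0 oppr0 point0.
Qed.

(** * Consequences of coprimality at the merged vertex *)

Hypothesis coprime_xy : gcdn (rvec s1 x) (rvec s2 y) = 1%N.

Let bezout : exists u v : int, u * (rvec s1 x)%:Z + v * (rvec s2 y)%:Z = 1.
Proof.
have [u [v uv]] := Bezoutz (rvec s1 x) (rvec s2 y).
by exists u, v; rewrite uv /gcdz /= coprime_xy.
Qed.

Lemma push_laplacian g1 g2 :
  exists g, push in1 (L1 g1) + push in2 (L2 g2) = L g.
Proof.
have [m [n mn1]] := bezout.
pose r1 := [ffun u => (rvec s1 u)%:Z]; pose r2 := [ffun u => (rvec s2 u)%:Z].
(* The gap [t] is closed by Bezout: the two corrections change the difference of values at [x] and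
   [y] by [t (m a + n b) = t], with [a = r1 x] and [b = r2 y]. *)
pose t := g2 y - g1 x.
pose h1 := g1 + r1 *~ (t * m); pose h2 := g2 - r2 *~ (t * n).
have h_xy : h1 x = h2 y.
  rewrite /h1 /h2 !ffunE !ffunMzE !ffunE !mulrzz -[LHS]addr0.
  rewrite -(subrr (t * 1)) -[in X in _ + (_ - X)]mn1 /t; ring.
have Lh1 : L1 h1 = L1 g1.
  by rewrite raddfD raddfMz /= laplacian_rvec mul0rz addr0.
have Lh2 : L2 h2 = L2 g2.
  by rewrite raddfB raddfMz /= laplacian_rvec mul0rz subr0.
move: h1 h2 h_xy Lh1 Lh2 => h1 h2 h_xy Lh1 Lh2.
exists [ffun p : vertex G =>
  match p with inl u => h1 u | inr w => h2 (val w) end].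
rewrite laplacian_wedge -Lh1 -Lh2; congr (push in1 (L1 _) + push in2 (L2 _)).
  by apply/ffunP=> u; rewrite !ffunE.
apply/ffunP=> v; rewrite !ffunE /wedge_in2.
by case: insubP => [w _ <-|/negPn/eqP->].
Qed.

(** Since the gcd is 1, the vector [rvec s] restricts to [b r1] and [a r2]. *)
Lemma degree_push f1 f2 :
  degree s (push in1 f1 + push in2 f2) =
  (rvec s2 y)%:Z * degree s1 f1 + (rvec s1 x)%:Z * degree s2 f2.
Proof.
have K (V' : finType) (h : V' -> vertex G) (f : {ffun V' -> int}) :
    degree s (push h f) = \sum_u (rvec s (h u))%:Z * f u.
  rewrite [RHS](partition_big h predT) //=; apply: eq_bigr => q _.
  by rewrite ffunE big_distrr /=; apply: eq_bigr => w /eqP->.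
rewrite raddfD /= !K /degree !big_distrr /=; congr (_ + _).
  by apply: eq_bigr => u _; rewrite coprime_xy divn1 PoszM mulrA.
by apply: eq_bigr => v _; rewrite wedge_rvec_in2 coprime_xy divn1 PoszM mulrA.
Qed.

Lemma push_degree0_surj f : degree s f = 0 ->
  exists f1 f2, degree s1 f1 = 0 /\ f = push in1 f1 + push in2 f2.
Proof.
have [f1 [f2 ->]] := push_wedge_surj f; rewrite degree_push => deg0.
have [m [n mn1]] := bezout.
(* With [m a + n b = 1], this makes [degree s1 f1 - a k] equal to
   [n (b degree s1 f1 + a degree s2 f2)], which is 0. *)
pose k := m * degree s1 f1 - n * degree s2 f2.
exists (f1 - point x k), (f2 + point y k); split; last first.
  by rewrite raddfB raddfD /= !push_point wedge_in2_y addrACA addNr addr0.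
rewrite raddfB /= degree_point -[degree s1 f1 in LHS]mul1r -mn1 /k.
transitivity (n * 0); last exact: mulr0.
rewrite -deg0; ring.
Qed.

(** * The gluing homomorphism on critical groups and its bijectivity *)

Let glue (z : critical_group s1 * critical_group s2) : {ffun vertex G -> int} :=
  push in1 (coker_repr (val z.1)) + push in2 (coker_repr (val z.2)).

(** Makes the choice of representatives in [glue] irrelevant: they change by Laplacians, which
    [push_laplacian] combines into one on the wedge. *)
Lemma coker_class_push_eq f1 f1' f2 f2' :
  coker_class s1 f1 = coker_class s1 f1' ->
  coker_class s2 f2 = coker_class s2 f2' ->
  coker_class s (push in1 f1 + push in2 f2) =
  coker_class s (push in1 f1' + push in2 f2').
Proof.
move=> /eqP; rewrite -subr_eq0 -raddfB => /eqP/coker_class_eq0[g1 Dg1].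
move=> /eqP; rewrite -subr_eq0 -raddfB => /eqP/coker_class_eq0[g2 Dg2].
apply/eqP; rewrite -subr_eq0 -raddfB opprD addrACA -!raddfB /= Dg1 Dg2.
by apply/eqP/coker_class_eq0; apply: push_laplacian.
Qed.

Lemma glue_torsion z : coker_class s (glue z) \in @torsion_pred (cokernel s).
Proof.
case: z => z1 z2.
have /asboolP[n1 n1_gt0 Dz1] := valP z1.
have /asboolP[n2 n2_gt0 Dz2] := valP z2.
apply/asboolP; exists (n1 * n2)%N; first by rewrite muln_gt0 n1_gt0.
rewrite -raddfMn mulrnDl -!raddfMn /= -(raddf0 (coker_class s)).
(* Writing 0 as a sum of two push-forwards of 0 lets the two sides be compared separately. *)
rewrite -[0](addr0 0) -[X in _ = coker_class s (X + _)](raddf0 (push in1)).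
rewrite -[X in _ = coker_class s (_ + X)](raddf0 (push in2)).
apply: coker_class_push_eq; rewrite raddfMn raddf0 /= coker_reprK.
  by rewrite mulrnA Dz1 mul0rn.
by rewrite mulnC mulrnA Dz2 mul0rn.
Qed.

Definition wedge_glue (z : critical_group s1 * critical_group s2) :
  critical_group s := Torsion (glue_torsion z).

Lemma wedge_glue_is_zmod_morphism : zmod_morphism wedge_glue.
Proof.
move=> z z'; apply: val_inj; rewrite raddfB /= -raddfB opprD addrACA -!raddfB.
by apply: coker_class_push_eq; rewrite /= !raddfB /= !coker_reprK.
Qed.

HB.instance Definition _ := GRing.isZmodMorphism.Build
  (critical_group s1 * critical_group s2)%type (critical_group s)
  wedge_glue wedge_glue_is_zmod_morphism.

Lemma wedge_glue_inj : injective wedge_glue.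
Proof.
apply: raddf_inj => -[z1 z2] z0.
have : coker_class s (glue (z1, z2)) = 0 := congr1 val z0.
case/coker_class_eq0=> g /laplacian_im_wedge[].
  by apply: torsion_degree0; rewrite coker_reprK; apply: (valP z1).
move=> /coker_class_eq0 z1_0 /coker_class_eq0 z2_0.
by congr (_, _); apply: val_inj; rewrite /= -[LHS]coker_reprK.
Qed.

Lemma wedge_glue_surj w : exists z, wedge_glue z = w.
Proof.
have tor_w : coker_class s (coker_repr (val w)) \in @torsion_pred (cokernel s).
  by rewrite coker_reprK; apply: (valP w).
have [f1 [f2 [deg_f1 Dw]]] := push_degree0_surj (torsion_degree0 tor_w).
(* An [n] that kills the class on the wedge also kills the classes of [f1] and [f2], because [n]
   times [f1] still has degree 0. *)
have /asboolP[n n_gt0] := tor_w; rewrite -raddfMn => /coker_class_eq0[g].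
rewrite Dw mulrnDl -!raddfMn => /laplacian_im_wedge[].
  by rewrite raddfMn /= deg_f1 mul0rn.
move=> /coker_class_eq0 n1 /coker_class_eq0 n2.
have tor1 : coker_class s1 f1 \in @torsion_pred (cokernel s1).
  by apply/asboolP; exists n; rewrite // -raddfMn.
have tor2 : coker_class s2 f2 \in @torsion_pred (cokernel s2).
  by apply/asboolP; exists n; rewrite // -raddfMn.
exists (Torsion tor1, Torsion tor2); apply: val_inj; rewrite /=.
rewrite -[RHS]coker_reprK Dw.
by apply: coker_class_push_eq; rewrite coker_reprK.
Qed.

End Wedge.

Theorem theorem3p3 (G1 G2 : multigraph) (x : vertex G1) (y : vertex G2)
    (s1 : arith_structure G1) (s2 : arith_structure G2) :
  connected_graph G1 -> connected_graph G2 ->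
  gcdn (rvec s1 x) (rvec s2 y) = 1%N ->
  zmod_isomorphic (critical_group (wedge_structure x y s1 s2))
                  (critical_group s1 * critical_group s2)%type.
Proof.
move=> _ _ gcd1.
apply: (@zmod_isomorphic_of_bij _ _ (wedge_glue gcd1)).
  exact: wedge_glue_inj.
exact: wedge_glue_surj.
Qed.
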